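(* For every $n\ge 1$, $$|\mathrm{Dom}_{T_n}(C_n)|=\binom{2n-2}{n-1}.$$
   Context: $X_n=\{1,2,\dots,n\}$ is the finite chain with its usual order, and $T_n$ is the full transformation semigroup of all maps $X_n\to X_n$, written on the right and composed left to right. The Catalan monoid $C_n$ is the subsemigroup of $T_n$ of all maps $\alpha$ that are both order-decreasing ($x\alpha\le x$ for all $x\in X_n$) and order-preserving ($x\le y\Rightarrow x\alpha\le y\alpha$ for all $x,y\in X_n$). For a subsemigroup $U$ of a semigroup $S$, an element $d\in S$ is dominated by $U$ if for every semigroup $T$ and all semigroup homomorphisms $f,g:S\to T$ with $f|_U=g|_U$ one has $(d)f=(d)g$; the dominion $\mathrm{Dom}_S(U)$ is the set of all elements of $S$ dominated by $U$ (a subsemigroup of $S$ containing $U$). *)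

(* Defs.v *)
From HB Require Import structures.
From mathcomp Require Import all_boot.
From mathcomp Require Import boolp classical_sets.

Set Implicit Arguments.
Unset Strict Implicit.
Unset Printing Implicit Defensive.

Local Open Scope group_scope.

(* The chain X_n = {1 < ... < n} is represented by 'I_n = {0 < ... < n.-1}.
   The maps are wrapped in an alias because {ffun _ -> _} already carries the
   pointwise product as its canonical multiplication. *)
Definition transf (n : nat) : Type := {ffun 'I_n -> 'I_n}.

HB.instance Definition _ (n : nat) := Finite.copy (transf n) {ffun 'I_n -> 'I_n}.

Definition transf_app (n : nat) (a : transf n) (x : 'I_n) : 'I_n :=
  (a : {ffun 'I_n -> 'I_n}) x.
Coercion transf_app : transf >-> Funclass.

(* Maps act on the right: x (a b) = (x a) b. *)
Definition transf_mul (n : nat) (a b : transf n) : transf n :=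
  [ffun x => b (a x)].

Fact transf_mulA (n : nat) : associative (@transf_mul n).
Proof.
by move=> a b c; apply/ffunP => x; rewrite /transf_mul /transf_app !ffunE.
Qed.

HB.instance Definition _ (n : nat) :=
  isSemigroup.Build (transf n) (@transf_mulA n).

Definition order_decreasing (n : nat) (a : transf n) : bool :=
  [forall x : 'I_n, (a x <= x)%N].

Definition order_preserving (n : nat) (a : transf n) : bool :=
  [forall x : 'I_n, forall y : 'I_n, (x <= y)%N ==> (a x <= a y)%N].

Definition catalan (n : nat) : {pred transf n} :=
  [pred a | order_decreasing a && order_preserving a].
Arguments catalan n : clear implicits.

Fact catalan_mulg_closed (n : nat) : mulg_closed (catalan n).
Proof.
move=> a b /andP[/forallP da /'forall_forallP pa].
move=> /andP[/forallP db /'forall_forallP pb].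
have mulE x : (a * b : transf n) x = b (a x) by rewrite /mul /= /transf_mul /transf_app ffunE.
apply/andP; split.
  by apply/forallP => x; rewrite mulE; apply: leq_trans (db _) (da _).
apply/'forall_forallP => x y; apply/implyP => xy; rewrite !mulE.
exact: (implyP (pb _ _) (implyP (pa _ _) xy)).
Qed.

HB.instance Definition _ (n : nat) :=
  isMulClosed.Build (transf n) (catalan n) (@catalan_mulg_closed n).

(* [semigroupType] includes a choiceType structure on the carrier; in the
   classical setting of [boolp] every type has one, so T is arbitrary. *)
Definition dominated (S : semigroupType) (U : mulgClosed S) (d : S) : Prop :=
  forall (T : semigroupType) (f g : {multiplicative S -> T}),
    {in U, f =1 g} -> f d = g d.

Definition dominion (S : semigroupType) (U : mulgClosed S) : set S :=
  [set d | dominated U d]%classic.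

(* Main.v *)
Require Import Defs.
From HB Require Import structures.
From mathcomp Require Import all_boot.
From mathcomp Require Import boolp classical_sets.

Set Implicit Arguments.
Unset Strict Implicit.
Unset Printing Implicit Defensive.

(** The dominion consists of the order-preserving maps fixing the least point
    (written 0 here), and those correspond to weakly increasing (n-1)-tuples
    over an n-chain.

    If b has an inverse w in U (b w b = b) with b w and w b in U, then any f, g
    agreeing on U satisfy f b = f b f (w b) = f b f w g b = f (b w) g b = g b.
    An order-preserving d fixing 0 factors as d = (d w) b with w in the Catalan
    monoid sending x to the rank of x in the image of d, b the section of w with
    image im d, and d w, b w, w b all in the Catalan monoid.

    Conversely, a dominated d commutes with every map of right acts that
    commutes with all of U; apply this to the constant map 0 and to the binary
    minimum. *)

Local Open Scope group_scope.

(** * Dominated elements of an arbitrary semigroup *)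

Lemma dominated_mem (S : semigroupType) (U : mulgClosed S) (u : S) :
  u \in U -> dominated U u.
Proof. by move=> uU T f g fg; apply: fg. Qed.

Lemma dominatedM (S : semigroupType) (U : mulgClosed S) (a b : S) :
  dominated U a -> dominated U b -> dominated U (a * b).
Proof. by move=> da db T f g fg; rewrite !gmulfM (da T f g) ?(db T f g). Qed.

Lemma dominated_inverse (S : semigroupType) (U : mulgClosed S) (w b : S) :
  w \in U -> b * w \in U -> w * b \in U -> b * w * b = b -> dominated U b.
Proof.
move=> wU bwU wbU bwb T f g fg.
rewrite -{1}bwb -mulgA gmulfM (fg _ wbU) gmulfM -(fg _ wU) mulgA -gmulfM.
by rewrite (fg _ bwU) -gmulfM bwb.
Qed.

Definition selfmap (Z : Type) : Type := Z -> Z.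

HB.instance Definition _ (Z : Type) := gen_eqMixin (selfmap Z).
HB.instance Definition _ (Z : Type) := gen_choiceMixin (selfmap Z).

(** Applying [b] first is what makes precomposition with a right action multiplicative. *)
Definition selfmap_mul (Z : Type) (a b : selfmap Z) : selfmap Z :=
  fun z => a (b z).

Fact selfmap_mulA (Z : Type) : associative (@selfmap_mul Z).
Proof. by []. Qed.

HB.instance Definition _ (Z : Type) :=
  isSemigroup.Build (selfmap Z) (@selfmap_mulA Z).

(* S acts on pairs (p, h) of predicates on A and B by precomposition; the second
   homomorphism is the conjugate of this action by the involution
   (p, h) |-> (p + h \o phi, h), which commutes with s when phi does. *)
Lemma dominated_equivariant (S : semigroupType) (U : mulgClosed S) (A : Type)
    (B : eqType) (actA : A -> S -> A) (actB : B -> S -> B) (phi : A -> B) d :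
    (forall a s t, actA a (s * t) = actA (actA a s) t) ->
    (forall b s t, actB b (s * t) = actB (actB b s) t) ->
    {in U, forall u a, phi (actA a u) = actB (phi a) u} ->
  dominated U d -> forall a, phi (actA a d) = actB (phi a) d.
Proof.
move=> actAM actBM phiU domd a.
pose Z := ((A -> bool) * (B -> bool))%type.
pose f (s : S) : selfmap Z :=
  fun z => (fun a => z.1 (actA a s), fun b => z.2 (actB b s)).
pose tau (z : Z) : Z := (fun a => z.1 a (+) z.2 (phi a), z.2).
have tauK z : tau (tau z) = z.
  case: z => p h; congr pair; apply/funext => x /=.
  by rewrite -addbA addbb addbF.
pose g (s : S) : selfmap Z := fun z => tau (f s (tau z)).
have fM : {morph f : s t / s * t}.
  move=> s t; apply/funext => z; rewrite /f; congr pair; apply/funext => x /=.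
    by rewrite actAM.
  by rewrite actBM.
have gM : {morph g : s t / s * t}.
  move=> s t; apply/funext => z.
  by rewrite {1}/g fM /mul /= /selfmap_mul /g tauK.
have fg : {in U, f =1 g}.
  move=> u uU; apply/funext => -[p h]; congr pair; apply/funext => x /=.
  by rewrite phiU // -addbA addbb addbF.
pose F := HB.pack_for {multiplicative S -> selfmap Z} f
  (isMultiplicative.Build _ _ f fM).
pose G := HB.pack_for {multiplicative S -> selfmap Z} g
  (isMultiplicative.Build _ _ g gM).
(* At the pair of the zero predicate and the indicator of [phi (actA a d)], [F d] gives false and
   [G d] gives true plus the truth value of the desired equality. *)
have /(congr1 (fun k : selfmap Z =>
  (k (xpred0, eq_op (phi (actA a d)))).1 a)) := domd _ F G fg.
rewrite /= eqxx.
by case: eqP => // ->.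
Qed.

(** * The dominion of the Catalan monoid *)

Lemma transf_mulE n (a b : transf n) (x : 'I_n) :
  (a * b : transf n) x = b (a x).
Proof. by rewrite /mul /= /transf_mul /transf_app ffunE. Qed.

Lemma catalanP n (a : transf n) :
  reflect ((forall x, a x <= x) /\ {homo a : x y / x <= y})%N (a \in catalan n).
Proof.
apply: (iffP andP) => -[].
  move=> /forallP dec /'forall_forallP mon.
  by split=> // x y /(implyP (mon x y)).
move=> dec mon; split; first exact/forallP.
by apply/'forall_forallP => x y; apply/implyP/mon.
Qed.

Section OrderPreservingFixingBottom.

Variable m : nat.
Implicit Types (d : transf m.+1) (i j x y c : 'I_m.+1).

Lemma dominated_catalan_fix0 d : dominated (catalan m.+1) d -> d ord0 = ord0.
Proof.
move=> domd; symmetry.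
have := @dominated_equivariant _ _ unit _ (fun t _ => t)
  (fun x (s : transf m.+1) => s x) (fun=> ord0) d _ _ _ domd tt.
apply=> // [b s t|u]; first exact: transf_mulE.
case/catalanP=> dec _ _; apply: val_inj => /=; apply/esym/eqP.
by rewrite -leqn0; apply: dec.
Qed.

(* An order-preserving map is exactly one commuting with binary minima. *)
Lemma dominated_catalan_homo d :
  dominated (catalan m.+1) d -> {homo d : x y / (x <= y)%N}.
Proof.
pose phi (p : 'I_m.+1 * 'I_m.+1) := if p.1 <= p.2 then p.1 else p.2.
move=> domd x y xy.
have := @dominated_equivariant _ _ _ _
  (fun p (s : transf m.+1) => (s p.1, s p.2)) (fun x (s : transf m.+1) => s x)
  phi d _ _ _ domd (x, y).
rewrite /phi /= xy; case: leqP => // lt_dydx dydx.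
suff /esym dxdy : d y = d x by rewrite dxdy ltnn in lt_dydx.
apply: dydx => [p s t|b s t|u /catalanP[_ mon] [p q] /=].
- by congr pair; apply: transf_mulE.
- exact: transf_mulE.
case: (leqP p q) => [/mon -> //|/ltnW/mon le_qp].
by case: leqP => // le_pq; apply/val_inj/anti_leq; rewrite le_pq.
Qed.

Section Factorization.

Variable d : transf m.+1.
Hypotheses (d0 : d ord0 = ord0) (d_homo : {homo d : x y / (x <= y)%N}).

(** Leaving out the image point 0 starts the ranks at 0 and keeps the rank of x at most x. *)
Let im_rank x := #|finset (fun c => (c \in codom d) && (0 < c <= x)%N)|.

Let im_rank_le x : (im_rank x <= x)%N.
Proof.
rewrite -[X in (_ <= X)%N]card_ord.
apply: leq_trans (leq_imset_card (fun j : 'I_x => inord j.+1 : 'I_m.+1) _).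
apply/subset_leq_card/fintype.subsetP => c; rewrite inE => /and3P[_ c0 cx].
have c1x : (c.-1 < x)%N by rewrite prednK.
apply/imsetP; exists (Ordinal c1x) => //=.
by rewrite prednK // inord_val.
Qed.

Let im_rank_homo x y : (x <= y)%N -> (im_rank x <= im_rank y)%N.
Proof.
move=> xy; apply/subset_leq_card/fintype.subsetP => c; rewrite !inE.
by case/and3P=> -> -> /= /leq_trans; apply.
Qed.

Let im_rank_lt x c : c \in codom d -> (x < c)%N -> (im_rank x < im_rank c)%N.
Proof.
move=> cd xc; apply/proper_card/properP; split.
  apply/fintype.subsetP => y; rewrite !inE; case/and3P=> -> -> /= yx.
  by rewrite (leq_trans yx) // ltnW.
exists c; rewrite !inE cd /= ?leqnn ?andbT; first exact: leq_ltn_trans xc.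
by rewrite [(c <= x)%N]leqNgt xc andbF.
Qed.

Let w : transf m.+1 := finfun (fun x => inord (im_rank x) : 'I_m.+1).

Let wE x : w x = im_rank x :> nat.
Proof.
by rewrite /w /transf_app ffunE inordK // (leq_ltn_trans (im_rank_le x)).
Qed.

Let w_cat : w \in catalan m.+1.
Proof.
apply/catalanP; split=> [x|x y xy]; rewrite !wE; first exact: im_rank_le.
exact: im_rank_homo.
Qed.

Let below i c := (c \in codom d) && (w c <= i)%N.

Let below0 i : below i ord0.
Proof.
rewrite /below -{1}d0 codom_f wE.
by apply: leq_trans (im_rank_le _) _.
Qed.

(** Asking for rank at most i, not exactly i, makes [b] total and monotone even beyond the largest
    rank. It need not be decreasing, hence the detour through [dominated_inverse]. *)
Let b : transf m.+1 :=
  finfun (fun i => [arg max_(c > ord0 | below i c) (c : nat)]).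

Let bP i : [/\ b i \in codom d, (w (b i) <= i)%N &
  forall c, c \in codom d -> (w c <= i)%N -> (c <= b i)%N].
Proof.
rewrite /b /transf_app ffunE; case: arg_maxnP => [|c /andP[cd wc] cmax].
  exact: below0.
by split=> // c' c'd wc'; apply: cmax; rewrite /below c'd.
Qed.

Let b_homo i j : (i <= j)%N -> (b i <= b j)%N.
Proof.
move=> ij; case: (bP i) => bd wb _; case: (bP j) => _ _; apply=> //.
exact: leq_trans wb ij.
Qed.

Let bwK c : c \in codom d -> b (w c) = c.
Proof.
move=> cd; case: (bP (w c)) => bd wb bmax; apply/val_inj/eqP.
rewrite eqn_leq bmax // andbT leqNgt; apply: contraL wb => cb.
by rewrite -ltnNge !wE im_rank_lt.
Qed.

Lemma dominated_of_homo_fix0 : dominated (catalan m.+1) d.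
Proof.
have [w_dec w_homo] := catalanP _ w_cat.
have dw_cat : d * w \in catalan m.+1.
  apply/catalanP; split=> [x|x y xy]; rewrite !transf_mulE; last first.
    by apply/w_homo/d_homo.
  (* Every nonzero image point up to [d x] is the value of [d] at some z with 0 < z <= x, so there
     are at most x of them. *)
  rewrite wE -[X in (_ <= X)%N]card_ord.
  apply: leq_trans (leq_imset_card (fun j : 'I_x => d (inord j.+1)) _).
  apply/subset_leq_card/fintype.subsetP => c.
  rewrite inE => /and3P[/codomP[y ->] dy0 dyx].
  have [z [zx dz]] : exists z : 'I_m.+1, (z <= x)%N /\ d z = d y.
    have [yx|/ltnW xy] := leqP y x; first by exists y.
    by exists x; split=> //; apply/val_inj/eqP; rewrite eqn_leq d_homo.
  have z0 : (0 < z)%N.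
    rewrite lt0n; apply: contraTneq dy0 => z0.
    by rewrite -[transf_app d y]dz (_ : z = ord0) ?d0 //; apply: val_inj.
  have z1x : (z.-1 < x)%N by rewrite prednK.
  apply/imsetP; exists (Ordinal z1x) => //=.
  by rewrite prednK // inord_val dz.
have -> : d = d * w * b.
  by apply/ffunP => x; rewrite -!/(transf_app _ _) !transf_mulE bwK // codom_f.
apply: dominatedM; first exact: dominated_mem.
apply: (dominated_inverse (w := w)) => //.
- apply/catalanP; split=> [x|x y xy]; rewrite !transf_mulE.
    by case: (bP x).
  by apply/w_homo/b_homo.
- apply/catalanP; split=> [x|x y xy]; rewrite !transf_mulE; last first.
    by apply/b_homo/w_homo.
  (* An image point above x has rank greater than that of x. *)
  case: (bP (w x)) => bd wb _; rewrite leqNgt; apply: contraL wb => xb.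
  by rewrite -ltnNge !wE im_rank_lt.
apply/ffunP => x; rewrite -!/(transf_app _ _) !transf_mulE bwK //.
by case: (bP x).
Qed.

End Factorization.

Lemma mem_dominion_catalanP d :
  reflect (d ord0 = ord0 /\ {homo d : x y / (x <= y)%N})
    (d \in dominion (catalan m.+1)).
Proof.
apply: (iffP idP) => [|[d0 d_homo]].
  rewrite in_setE => domd.
  by split; [apply: dominated_catalan_fix0 | apply: dominated_catalan_homo].
by rewrite in_setE; apply: dominated_of_homo_fix0.
Qed.

End OrderPreservingFixingBottom.

(** * Counting by increasing tuples *)

Lemma sorted_tupleP m n (t : m.-tuple 'I_n) :
  reflect {homo tnth t : i j / (i <= j)%N} (sorted leq [seq val i | i <- t]).
Proof.
case: n t => [|n] t.
  case: m t => [t|m t]; last by case: (tnth t ord0).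
  by rewrite tuple0; apply: ReflectT => -[].
rewrite sorted_map; apply: (iffP idP) => [st i j ij|homo_t].
  rewrite !(tnth_nth ord0).
  apply: (sorted_leq_nth _ _ _ st) => //; rewrite ?inE ?size_tuple //.
  - by move=> x y z /=; apply: leq_trans.
  - by move=> x /=.
apply/(sortedP ord0) => i; rewrite size_tuple => im.
have := homo_t (Ordinal (ltnW im)) (Ordinal im) (leqnSn i).
by rewrite !(tnth_nth ord0).
Qed.

Lemma card_dominion_catalan m :
  #|dominion (catalan m.+1)| = 'C(m + m, m).
Proof.
rewrite -card_sorted_tuples.
(* The value at 0 is forced, so the other m values determine the map. *)
pose tl (d : transf m.+1) : m.-tuple 'I_m.+1 := [tuple d (lift ord0 i) | i < m].
have tl_inj : {in dominion (catalan m.+1) &, injective tl}.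
  move=> d e /mem_dominion_catalanP[d0 _] /mem_dominion_catalanP[e0 _] de.
  apply/ffunP => x; rewrite -!/(transf_app _ _).
  case: (unliftP ord0 x) => [i|] ->; last by rewrite d0 e0.
  by have := congr1 (fun t => tnth t i) de; rewrite !tnth_mktuple.
rewrite -(card_in_imset tl_inj); apply: eq_card => t; rewrite !inE.
apply/imsetP/sorted_tupleP => [[d /mem_dominion_catalanP[_ d_homo] ->] i j ij|].
  by rewrite !tnth_mktuple; apply: d_homo; rewrite !lift0.
(* Conversely, prepending the least value 0 keeps a tuple increasing. *)
move=> t_homo; pose d : transf m.+1 :=
  finfun (fun x => if unlift ord0 x is Some i then tnth t i else ord0).
have dE x : d x = if unlift ord0 x is Some i then tnth t i else ord0.
  by rewrite /d /transf_app ffunE.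
exists d; last by apply: eq_from_tnth => i; rewrite tnth_mktuple dE liftK.
apply/mem_dominion_catalanP; split=> [|x y]; first by rewrite dE unlift_none.
rewrite !dE; case: (unliftP ord0 x) => [i|] -> //.
by case: (unliftP ord0 y) => [j|] -> //; rewrite !lift0; apply: t_homo.
Qed.

Theorem mainTheorem12 (n : nat) (hn : (1 <= n)%N) :
  #|dominion (catalan n)| = 'C(2 * n - 2, n - 1).
Proof.
case: n hn => // m _.
by rewrite card_dominion_catalan mulnS addKn subn1 mul2n -addnn.
Qed.
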